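(* Let $G$ be a finite group, let $M$ be an indecomposable $\mathbb{F}G$-module and let $E$ be an elementary abelian $p$-subgroup of $G$ of rank $r$ (with a fixed ordered set of generators $g_1,\dots,g_r$). If the rank variety $V^\#_E(M{\downarrow_E})\subseteq\mathbb{F}^r$ is not contained in the union of the proper base subspaces of $\mathbb{F}^r$, then $E$ is a subgroup of a Green vertex of $M$.
   Context: $\mathbb{F}$ is an algebraically closed field of positive characteristic $p$; all modules are finite-dimensional over $\mathbb{F}$; $M{\downarrow_E}$ denotes restriction. Green vertex: for an indecomposable $\mathbb{F}G$-module $M$, a Green vertex of $M$ is a minimal subgroup $Q\le G$ such that $M$ is (isomorphic to) a direct summand of an induced module $S{\uparrow^G}$ for some indecomposable $\mathbb{F}Q$-module $S$. It is a $p$-subgroup, unique up to $G$-conjugacy. Rank variety: let $E=\langle g_1,\dots,g_r\rangle$ be elementary abelian of rank $r$, $X_i=g_i-1\in\mathbb{F}E$. For $0\ne\alpha=(\alpha_1,\dots,\alpha_r)\in\mathbb{A}^r(\mathbb{F})=\mathbb{F}^r$ put $u_\alpha=1+\sum_i\alpha_iX_i$, a unit of order $p$ in $\mathbb{F}E$. For an $\mathbb{F}E$-module $N$, $V^\#_E(N)=\{0\}\cup\{0\neq\alpha\in\mathbb{A}^r(\mathbb{F}): N{\downarrow_{\langle u_\alpha\rangle}}\text{ is not a free }\mathbb{F}\langle u_\alpha\rangle\text{-module}\}$. Base subspace: a subspace $W$ of $\mathbb{F}^r$ is a base subspace if it has a basis consisting of vectors in $\mathbb{F}_p^r$, where $\mathbb{F}_p$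 is the prime subfield of $\mathbb{F}$. There are finitely many base subspaces; the union is over all proper ones. *)

(* Defs.v *)
(* A finite-dimensional FG-module of dimension n is a matrix
   representation [rG : mx_representation F G n], acting on row vectors from
   the right; submodules are row spaces. *)
From mathcomp Require Import all_boot all_order all_algebra.
From mathcomp Require Import all_fingroup all_solvable all_character.

Set Implicit Arguments.
Unset Strict Implicit.
Unset Printing Implicit Defensive.

Import GRing.Theory.
Local Open Scope ring_scope.

Section Modules.

Variables (F : fieldType) (gT : finGroupType).
Implicit Types G Q R : {group gT}.

Definition indecomposable G n (rG : mx_representation F G n) : Prop :=
  (0 < n)%N /\
  forall U V : 'M[F]_n,
    mxmodule rG U -> mxmodule rG V ->
    (U + V :=: 1%:M)%MS -> mxdirect (U + V) -> U = 0 \/ V = 0.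

Definition iso_to_summand G m (rM : mx_representation F G m)
    n (rN : mx_representation F G n) : Prop :=
  exists (U V : 'M[F]_n) (modU : mxmodule rN U),
    [/\ mxmodule rN V, (U + V :=: 1%:M)%MS, mxdirect (U + V)
      & mx_rsim rM (submod_repr modU)].

Definition coset_rep Q G (i : 'I_#|G : Q|%g) : gT :=
  repr (enum_val i : {set gT}).

(* The induced module S (x)_{FQ} FG is the direct sum of the S (x) t_i, where
   the t_i represent the right cosets of Q in G.  If t_i x = h t_j with h in Q,
   then x maps s (x) t_i to (s h) (x) t_j. *)
Definition induced_mx Q G m (S : mx_representation F Q m) (x : gT) :
    'M[F]_(\sum_(i < #|G : Q|%g) m) :=
  \mxblock_(i < #|G : Q|%g, j < #|G : Q|%g)
     (let h := (coset_rep i * x * (coset_rep j)^-1)%g in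
      if h \in Q then S h else 0).

Lemma coset_rep_uniq Q G (i j : 'I_#|G : Q|%g) :
  (coset_rep i * (coset_rep j)^-1)%g \in Q -> i = j.
Proof.
have repK (k : 'I_#|G : Q|%g) : (Q :* coset_rep k)%g = enum_val k.
  have /rcosetsP[y _ Ek] := enum_valP k.
  by rewrite /coset_rep Ek rcoset_repr.
move=> Qij; apply: enum_val_inj; rewrite -!repK.
by apply/rcoset_eqP; rewrite mem_rcoset.
Qed.

Lemma coset_rep_ex Q G (i : 'I_#|G : Q|%g) x : x \in G ->
  exists j : 'I_#|G : Q|%g, (coset_rep i * x * (coset_rep j)^-1)%g \in Q.
Proof.
move=> Gx; have /rcosetsP[y Gy Ei] := enum_valP i.
have Cyx : (Q :* (y * x))%g \in rcosets Q G.
  by apply/rcosetsP; exists (y * x)%g; rewrite ?groupM.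
exists (enum_rank_in Cyx (Q :* (y * x))%g).
rewrite /coset_rep enum_rankK_in // Ei.
case: repr_rcosetP => a Qa; case: repr_rcosetP => b Qb.
by rewrite !invMg -!mulgA !mulKVg groupM ?groupV.
Qed.

Lemma induced_mx_repr Q G m (S : mx_representation F Q m) :
  mx_repr G (induced_mx G S).
Proof.
split=> [|x y Gx Gy].
  rewrite -(mxdiagZ (p_ := fun=> m)) /mxdiag; apply: eq_mxblock => i j /=.
  rewrite mulg1; case: eqVneq => [<- | ne_ij].
    by rewrite mulgV group1 repr_mx1 conform_mx_id.
  by case: ifP => // /coset_rep_uniq Eij; rewrite Eij eqxx in ne_ij.
rewrite /induced_mx mul_mxblock; apply: eq_mxblock => i k /=.
have [j Qij] := coset_rep_ex i Gx.
rewrite (bigD1 j) //= Qij big1 ?addr0 => [|l ne_lj]; last first.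
  case: ifP => [Qil|_]; last by rewrite mul0mx.
  case/eqP: ne_lj; apply: coset_rep_uniq; rewrite -groupV in Qil.
  have := groupM Qil Qij; rewrite !invMg invgK !mulgA !mulgKV => ?.
  by rewrite ?mulgA.
have -> : (coset_rep i * (x * y) * (coset_rep k)^-1 =
  coset_rep i * x * (coset_rep j)^-1 * (coset_rep j * y * (coset_rep k)^-1))%g.
  by rewrite !mulgA mulgKV.
rewrite groupMl //; case: ifP => Qjk; last by rewrite mulmx0.
by rewrite repr_mxM.
Qed.

Definition induced_repr Q G m (S : mx_representation F Q m) :
    mx_representation F G (\sum_(i < #|G : Q|%g) m) :=
  MxRepresentation (induced_mx_repr G S).

Definition vertex_candidate G n (rG : mx_representation F G n) Q : Prop :=
  Q \subset G /\
  exists m (S : mx_representation F Q m),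
    indecomposable S /\ iso_to_summand rG (induced_repr G S).

Definition green_vertex G n (rG : mx_representation F G n) Q : Prop :=
  vertex_candidate rG Q /\
  forall R, R \subset Q -> vertex_candidate rG R -> R :=: Q.

End Modules.

Section RankVariety.

Variables (F : fieldType) (gT : finGroupType) (E : {group gT}).
Variables (r : nat) (g : 'I_r -> gT).

(* u_alpha as an element of the group algebra FE, which MathComp realizes
   inside 'M_#|E| by the regular representation. *)
Definition shifted_unit (alpha : 'rV[F]_r) : 'M[F]_(gcard E) :=
  1%:M + \sum_(i < r) alpha 0 i *: (regular_repr F E (g i) - 1%:M).

(* For u in FE of multiplicative order p: the rows of b are a basis of N over
   F<u>.  The group algebra F<u> has F-basis 1, u, ..., u^(p-1), so the element
   of F<u> multiplying the i-th row of b is the sum of the c i j u^j. *)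
Definition free_on_powers (p : nat) n (rN : mx_representation F E n)
    (u : 'M[F]_(gcard E)) : Prop :=
  exists d (b : 'M[F]_(d, n)), forall w : 'rV[F]_n,
    exists! c : 'M[F]_(d, p),
      w = \sum_(i < d) row i b *m
            gring_op rN (\sum_(j < p) c i j *: u ^+ j).

Definition rank_variety (p : nat) n (rN : mx_representation F E n)
    (alpha : 'rV[F]_r) : Prop :=
  alpha = 0 \/ (alpha != 0 /\ ~ free_on_powers p rN (shifted_unit alpha)).

(* In characteristic p the prime subfield is the image of the integers, i.e.
   the set of the c%:R. *)
Definition base_subspace (W : 'M[F]_r) : Prop :=
  exists k (B : 'M[F]_(k, r)),
    [/\ row_free B, (B :=: W)%MS & forall i j, exists c : nat, B i j = c%:R].

Definition proper_base_union (alpha : 'rV[F]_r) : Prop :=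
  exists W : 'M[F]_r,
    [/\ base_subspace W, (W < (1%:M : 'M[F]_r))%MS & (alpha <= W)%MS].

End RankVariety.

(* For alpha <> 0 the unit u_alpha has order exactly p, as [free_on_powers]
   requires. *)
Section ShiftedUnitOrder.

Variables (F : fieldType) (gT : finGroupType) (E : {group gT}).
Variables (p r : nat) (g : 'I_r -> gT).
Hypotheses (charFp : p \in [pchar F]) (abelE : p.-abelem%g E).

Lemma mx_expDp n (A B : 'M[F]_n) : A *m B = B *m A ->
  (A + B) ^+ p = A ^+ p + B ^+ p.
Proof.
case: n A B => [|n] A B cAB; first exact: etrans (flatmx0 _) (esym (flatmx0 _)).
have charM : p \in [pchar 'M[F]_n.+1] by rewrite pchar_lalg.
by rewrite -!(pFrobenius_autE charM) pFrobenius_autD_comm.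
Qed.

Lemma shifted_unit_expp (alpha : 'rV[F]_r) : (forall i, g i \in E) ->
  shifted_unit E g alpha ^+ p = 1.
Proof.
move=> Eg; have /(abelemP (pcharf_prime charFp))[abE expE] := abelE.
pose X i : 'M[F]_(gcard E) := alpha 0 i *: (regular_repr F E (g i) - 1%:M).
have cX i j : comm_mx (X i) (X j).
  rewrite /comm_mx /X -!scalemxAl -!scalemxAr scalerA mulrC -scalerA.
  congr (_ *: (_ *: _)).
  rewrite !mulmxBl !mulmxBr !mul1mx !mulmx1 -!repr_mxM ?Eg //.
  by rewrite (centsP abE) ?Eg // !opprD !opprK addrACA.
have Xp i : X i ^+ p = 0.
  have gp : regular_repr F E (g i) ^+ p = 1.
    have gX k : regular_repr F E (g i ^+ k)%g = regular_repr F E (g i) ^+ k.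
      elim: k => [|k IHk]; first by rewrite repr_mx1.
      by rewrite expgS exprS repr_mxM ?groupX ?Eg // IHk.
    by rewrite -gX expE ?Eg ?repr_mx1.
  have Zp k (a : F) (A : 'M_(gcard E)) : (a *: A) ^+ k = a ^+ k *: A ^+ k.
    elim: k => [|k IHk]; first by rewrite !expr0 scale1r.
    by rewrite !exprS IHk -[LHS]scalemxAl -scalemxAr scalerA.
  have := @mx_expDp _ (regular_repr F E (g i) - 1%:M) 1%:M.
  rewrite mulmx1 mul1mx subrK gp expr1n => /(_ erefl)/esym/eqP.
  by rewrite -subr_eq0 addrK /X Zp => /eqP ->; rewrite scaler0.
have sum0 s : (\sum_(i <- s) X i) ^+ p = 0.
  elim: s => [|i s IHs].
    by rewrite big_nil expr0n gtn_eqF ?prime_gt0 // (pcharf_prime charFp).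
  rewrite big_cons mx_expDp ?Xp ?IHs ?addr0 //.
  exact: comm_mx_sum.
rewrite /shifted_unit mx_expDp ?mul1mx ?mulmx1 // sum0 addr0.
exact: expr1n.
Qed.

Lemma shifted_unit_neq1 (alpha : 'rV[F]_r) :
    'r(E)%g = r -> <<[set g i | i : 'I_r]>>%g = E :> {set gT} ->
  alpha != 0 -> shifted_unit E g alpha != 1.
Proof.
move=> rE gE; apply: contraNneq.
have Eg i : g i \in E by rewrite -gE mem_gen // imset_f.
rewrite /shifted_unit -[X in _ = X]addr0 => /addrI sum0.
have small (S : {set gT}) : <<S>>%g = E :> {set gT} -> (r <= #|S|)%N.
  move=> gS; rewrite -rE -grank_abelian ?(abelem_abelian abelE) //.
  by rewrite -gS grank_min.
have injg : injective g.
  have /imset_injP injT : #|[set g i | i : 'I_r]| == #|'I_r|.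
    by rewrite eqn_leq leq_imset_card card_ord small.
  by move=> i j; apply: injT.
have g_neq1 i : g i != 1%g.
  apply/eqP=> gi1; have /small : <<[set g i | i : 'I_r]^#>>%g = E :> {set gT}.
    by rewrite genD1id.
  rewrite leqNgt; case/negP; apply: leq_trans (_ : #|[set g i | i : 'I_r]| <= r)%N.
    by rewrite [X in (_ < X)%N](cardsD1 1%g) -{2}gi1 imset_f.
  by rewrite -[X in (_ <= X)%N]card_ord leq_imset_card.
apply/eqP/rowP=> k; rewrite mxE.
have := congr1 (fun A => gring_proj (g k) A 0 0) sum0.
rewrite linear_sum linear0 summxE [RHS]mxE (bigD1 k) //= big1 => [|i ne_ik].
  rewrite addr0 linearZ linearB /= gring_projE ?Eg // -(repr_mx1 (regular_repr F E)).
  by rewrite gring_projE ?Eg ?group1 // eqxx (negPf (g_neq1 k)) subr0 !mxE mulr1.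
rewrite linearZ linearB /= gring_projE ?Eg // -(repr_mx1 (regular_repr F E)).
rewrite gring_projE ?Eg ?group1 // (inj_eq injg) eq_sym (negPf ne_ik).
by rewrite (negPf (g_neq1 k)) subr0 !mxE mulr0.
Qed.

End ShiftedUnitOrder.

(* Main.v *)
(* If M is a summand of a module induced from Q, the projections onto the
   summands S (x) t of the induced module give endomorphisms f_C of M, one for
   each right coset C of Q in G, with sum 1 and f_(Cx) = x^-1 f_C x.  Suppose
   that E fixes no coset, i.e. lies in no conjugate of Q.  Each E-orbit has
   its stabilizer in a maximal subgroup H of E, so the f_C of the orbit add up
   to sum_(j < p) e^-j theta e^j with E = H<e> and theta commuting with H.  In
   characteristic p this trace is, up to a unit, (ad e)^(p-1) theta.  When
   alpha lies outside the base hyperplane attached to H, ad u_alpha and ad e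
   differ by an invertible factor on maps commuting with H.  Hence
   1 = (ad Y)^(p-1) B for Y = u_alpha - 1 and some B, and any v with v Y = 0
   satisfies v = v B Y^(p-1) up to sign.  So the kernel of Y is the image of
   Y^(p-1), which means that M is free over F<u_alpha>. *)
From Stdlib Require Import Classical_Prop.
From HB Require Import structures.
Require Import Defs.
From mathcomp Require Import all_boot all_order all_algebra.
From mathcomp Require Import all_fingroup all_solvable all_character.

Set Implicit Arguments.
Unset Strict Implicit.
Unset Printing Implicit Defensive.

Import GRing.Theory.
Local Open Scope ring_scope.

(** * Induced modules: summands, change of transversal, conjugation *)

Section Candidates.

Variables (F : fieldType) (gT : finGroupType).
Implicit Types G Q R : {group gT}.

(** Summands as equivariant split injections, which compose more easily than pairs of complementary
    submodules. *)
Definition retract G m (rM : mx_representation F G m)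
    n (rN : mx_representation F G n) : Prop :=
  exists (i : 'M[F]_(m, n)) (q : 'M[F]_(n, m)),
    [/\ i *m q = 1%:M, forall x, x \in G -> rM x *m i = i *m rN x
      & forall x, x \in G -> rN x *m q = q *m rM x].

Lemma retract_of_summand G m (rM : mx_representation F G m)
    n (rN : mx_representation F G n) :
  iso_to_summand rM rN -> retract rM rN.
Proof.
case=> U [V [modU [modV defUV dxUV /mx_rsim_def[B [B' B'B defM]]]]].
have BB' : B *m B' = 1%:M by rewrite -(repr_mx1 rM) defM // repr_mx1 mulmx1.
have dx0 : (U :&: V = 0)%MS by apply/mxdirect_addsP.
have homP x : x \in G -> proj_mx U V *m rN x = rN x *m proj_mx U V.
  move=> Gx; have : (1%:M <= dom_hom_mx rN (proj_mx U V))%MS.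
    by rewrite -defUV proj_mx_hom.
  by move/hom_mxP/(_ x Gx); rewrite !mul1mx.
exists (val_submod B), (in_submod U (proj_mx U V) *m B'); split=> [|x Gx|x Gx].
- rewrite mulmxA in_submodE mulmxA -in_submodE proj_mx_id ?val_submodP //.
  by rewrite val_submodK.
- rewrite -(val_submodJ modU) // defM // [val_submod B]val_submodE.
  rewrite (mulmxA _ B) -(mulmxA _ B' B) B'B mulmx1.
  by rewrite -val_submodE.
- have -> : in_submod U (proj_mx U V) *m B' *m rM x
      = in_submod U (proj_mx U V *m rN x) *m B'.
    rewrite (in_submodJ modU); last first.
      by have := proj_mx_sub U V 1%:M; rewrite mul1mx.
    rewrite defM // -[LHS]mulmxA -[RHS]mulmxA; congr (_ *m _).
    by rewrite mulmxA mulmxA B'B mul1mx.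
  rewrite homP // [LHS]mulmxA; congr (_ *m _).
  by rewrite in_submodE mulmxA -in_submodE.
Qed.

(** The idempotent [q *m i] is equivariant, so its image and kernel are complementary submodules. *)
Lemma summand_of_retract G m (rM : mx_representation F G m)
    n (rN : mx_representation F G n) :
  retract rM rN -> iso_to_summand rM rN.
Proof.
case=> i [q [iq homi homq]].
have modU : mxmodule rN (q *m i).
  apply/mxmoduleP=> x Gx; rewrite -mulmxA -homi // mulmxA -homq //.
  by rewrite -mulmxA submxMl.
have defU : (q *m i :=: i)%MS.
  by apply/eqmxP; rewrite submxMl -[X in (X <= _)%MS]mul1mx -iq -mulmxA submxMl.
have qiqi : q *m i *m (q *m i) = q *m i.
  by rewrite mulmxA -(mulmxA q) iq mulmx1.
exists (q *m i), (kermx (q *m i)), modU; split.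
- apply/mxmoduleP=> x Gx; apply/sub_kermxP.
  rewrite -mulmxA (mulmxA (rN x)) homq // -(mulmxA q) homi // (mulmxA q).
  by rewrite mulmxA mulmx_ker mul0mx.
- apply/eqmxP; rewrite submx1 /= -[1%:M](subrK (q *m i)) addrC.
  rewrite addmx_sub_adds ?submx_refl //; apply/sub_kermxP.
  by rewrite mulmxBl mul1mx qiqi subrr.
- apply/mxdirect_addsP/eqP; rewrite -submx0; apply/rV_subP=> v.
  rewrite sub_capmx => /andP[/submxP[w ->] /sub_kermxP].
  by rewrite -mulmxA qiqi => ->; apply: sub0mx.
have freei : row_free i by apply/row_freeP; exists q.
have rankU : \rank (q *m i) = m by rewrite defU; apply/eqP.
exists (in_submod (q *m i) i) => // [|x Gx].
  by rewrite /row_free mxrank_in_submod ?defU.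
rewrite -in_submodJ ?defU // -homi //.
by rewrite [in_submod _ i]in_submodE mulmxA -in_submodE.
Qed.

Section Transversals.

Variables (Q : {group gT}) (m : nat) (S : mx_representation F Q m).

(* For a and b right transversals of Q in G, this is the matrix of the
   identity of S (x)_{FQ} FG with respect to the two decompositions into the
   S (x) a_i and the S (x) b_j. *)
Definition transversal_mx k l (a : 'I_k -> gT) (b : 'I_l -> gT) :
    'M[F]_(\sum_(i < k) m, \sum_(j < l) m) :=
  \mxblock_(i < k, j < l)
     (if (a i * (b j)^-1)%g \in Q then S (a i * (b j)^-1)%g else 0).

Definition meets_once k l (a : 'I_k -> gT) (b : 'I_l -> gT) :=
  forall i, exists j, (a i * (b j)^-1)%g \in Q
    /\ forall j', (a i * (b j')^-1)%g \in Q -> j' = j.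

(** By [meets_once] a single [j] contributes to each row of blocks; there [a i] lies in the coset of
    [b j], so the remaining membership tests agree and [S] is multiplicative. *)
Lemma transversal_mxM k l o (a : 'I_k -> gT) (b : 'I_l -> gT)
    (c : 'I_o -> gT) :
  meets_once a b ->
  transversal_mx a b *m transversal_mx b c = transversal_mx a c.
Proof.
move=> ab; rewrite /transversal_mx mul_mxblock; apply: eq_mxblock => i h /=.
have [j [Qij uniqj]] := ab i.
rewrite (bigD1 j) //= Qij big1 ?addr0 => [|j' ne_j'j]; last first.
  by case: ifP => [/uniqj Ej' | _];
    [rewrite Ej' eqxx in ne_j'j | rewrite mul0mx].
have -> : (a i * (c h)^-1 = a i * (b j)^-1 * (b j * (c h)^-1))%g.
  by rewrite mulgA mulgKV.
rewrite (groupMl _ Qij); have [Qjh|_] := boolP (_ \in Q);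
  last by rewrite mulmx0.
by rewrite [RHS]repr_mxM.
Qed.

Lemma transversal_mx1 k (a : 'I_k -> gT) :
  (forall i j, (a i * (a j)^-1)%g \in Q -> i = j) -> transversal_mx a a = 1%:M.
Proof.
move=> inja; rewrite -(mxdiagZ (p_ := fun=> m)) /mxdiag.
apply: eq_mxblock => i j /=; case: eqVneq => [<- | ne_ij].
  by rewrite mulgV group1 repr_mx1 conform_mx_id.
by case: ifP => // /inja Eij; rewrite Eij eqxx in ne_ij.
Qed.

End Transversals.

Lemma coset_rep_meets Q G k (a : 'I_k -> gT) :
  (forall i, a i \in G) -> meets_once Q a (@coset_rep _ Q G).
Proof.
move=> Ga i; have Cai : (Q :* a i)%g \in rcosets Q G.
  by apply/rcosetsP; exists (a i).
exists (enum_rank_in Cai (Q :* a i)%g).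
have Qi : (a i * (coset_rep (enum_rank_in Cai (Q :* a i)%g))^-1)%g \in Q.
  rewrite /coset_rep enum_rankK_in //; case: repr_rcosetP => h Qh.
  by rewrite invMg mulVKg groupV.
split=> // j Qj; apply: coset_rep_uniq; rewrite -groupV in Qj.
by have := groupM Qj Qi; rewrite invMg invgK -mulgA mulKg.
Qed.

Lemma coset_rep_in Q G (i : 'I_#|G : Q|%g) :
  Q \subset G -> coset_rep i \in G.
Proof.
move=> sQG; have /rcosetsP[y Gy Ei] := enum_valP i.
rewrite /coset_rep Ei; case: repr_rcosetP => h Qh.
by rewrite groupM // (subsetP sQG).
Qed.

Section Conjugate.

Variables (Q : {group gT}) (m : nat) (S : mx_representation F Q m) (x : gT).

Lemma conj_mx_repr : mx_repr (Q :^ x)%g (fun y => S (y ^ x^-1)%g).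
Proof.
split=> [|y z]; first by rewrite conj1g repr_mx1.
by rewrite !mem_conjg => Qy Qz; rewrite conjMg repr_mxM.
Qed.

Definition conj_repr : mx_representation F (Q :^ x)%G m :=
  MxRepresentation conj_mx_repr.

Lemma conj_repr_indecomposable : indecomposable S -> indecomposable conj_repr.
Proof.
case=> m_gt0 indS; split=> // U V.
have modS (W : 'M_m) : mxmodule conj_repr W -> mxmodule S W.
  move/mxmoduleP=> modW; apply/mxmoduleP=> y Qy.
  by have := modW (y ^ x)%g; rewrite memJ_conjg /= conjgK; apply.
by move=> /modS modU /modS modV; apply: indS.
Qed.

End Conjugate.

(** Acting by [x] replaces the transversal t by t x, so equivariance reduces to products of
    change-of-transversal matrices. *)
Lemma induced_transversal Q G m (S : mx_representation F Q m) x :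
  induced_mx G S x =
  transversal_mx S (fun i : 'I_#|G : Q|%g => coset_rep i * x)%g (@coset_rep _ Q
    G).
Proof. by []. Qed.

Lemma vertex_candidate_self G n (rG : mx_representation F G n) :
  indecomposable rG -> vertex_candidate rG G.
Proof.
move=> indG; split=> //; exists n, rG; split=> //.
apply: summand_of_retract.
pose t := @coset_rep _ G G; have Gt i : t i \in G by apply: coset_rep_in.
(* The index is 1, so the block sums collapse; the embedding is v |-> v t^-1 (x) t for the only
   representative t. *)
exists (\mxrow_j rG (t j)^-1%g), (\mxcol_j rG (t j)); split=> [|x Gx|x Gx].
- rewrite mul_mxrow_mxcol (eq_bigr (fun=> 1%:M)) => [|i _]; last first.
    by rewrite -repr_mxM ?groupV // mulVg repr_mx1.
  by rewrite sumr_const card_ord indexgg mulr1n.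
- rewrite mul_mxrow mul_mxrow_mxblock; apply: eq_mxrow => j /=.
  rewrite (eq_bigr (fun=> rG x *m rG (t j)^-1%g)) => [|i _]; last first.
    by rewrite !groupM ?groupV ?Gt // -!repr_mxM ?groupM ?groupV ?Gt // !mulgA
      mulVg mul1g.
  by rewrite sumr_const card_ord indexgg mulr1n.
- rewrite mxcol_mul mul_mxblock_mxrow; apply: eq_mxcol => i /=.
  rewrite (eq_bigr (fun=> rG (t i) *m rG x)) => [|j _]; last first.
    by rewrite !groupM ?groupV ?Gt // -!repr_mxM ?groupM ?groupV ?Gt // mulgKV.
  by rewrite sumr_const card_ord indexgg mulr1n.
Qed.

(** If the r_j represent the right cosets of Q^x, the x r_j form a right transversal of Q. Inducing
    the conjugate module thus amounts to inducing [S] along another transversal. *)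
Lemma vertex_candidateJ G n (rG : mx_representation F G n) Q x :
  x \in G -> vertex_candidate rG Q -> vertex_candidate rG (Q :^ x)%G.
Proof.
move=> Gx [sQG [m [S [indS /retract_of_summand[i [q [iq homi homq]]]]]]].
have sQxG : (Q :^ x)%G \subset G by rewrite /= -(conjGid Gx) conjSg.
split=> //; exists m, (conj_repr S x); split;
  first exact: conj_repr_indecomposable.
apply: summand_of_retract.
pose t := @coset_rep _ Q G.
pose u (j : 'I_#|G : (Q :^ x)%G|%g) := (x * coset_rep j)%g.
have Gt k : t k \in G by apply: coset_rep_in.
have Gu k : u k \in G by rewrite groupM ?coset_rep_in.
have Ju y k l : (coset_rep k * y * (coset_rep l)^-1 \in Q :^ x)%g
    = (u k * y * (u l)^-1 \in Q)%g.
  by rewrite mem_conjg conjgE invgK invMg !mulgA.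
have meet_u k (a : 'I_k -> gT) : (forall j, a j \in G) -> meets_once Q a u.
  move=> Ga j.
  have [|l] := @coset_rep_meets (Q :^ x)%G G k (fun j => x^-1 * a j)%g _ j.
    by move=> j'; rewrite groupM ?groupV.
  have E l' : (x^-1 * a j * (coset_rep l')^-1 \in Q :^ x)%g
      = (a j * (u l')^-1 \in Q)%g.
    by rewrite mem_conjg conjgE invgK invMg !mulgA mulgV mul1g.
  by rewrite E => -[Ql uniql]; exists l; split=> // l'; rewrite -E;
    apply: uniql.
have meet_t k (a : 'I_k -> gT) : (forall j, a j \in G) -> meets_once Q a t.
  by move=> Ga; apply: coset_rep_meets.
have ind_u y : induced_mx G (conj_repr S x) y =
    transversal_mx S (fun k => u k * y)%g u.
  apply: eq_mxblock => k l /=; rewrite Ju; case: ifP => // _.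
  by rewrite conjgE invgK invMg !mulgA.
have tuM k (b : 'I_k -> gT) := transversal_mxM S b (meet_u _ _ Gt).
have utM k (b : 'I_k -> gT) := transversal_mxM S b (meet_t _ _ Gu).
have Guy y : y \in G -> forall k, (u k * y)%g \in G by move=> Gy k;
  rewrite groupM.
have Gty y : y \in G -> forall k, (t k * y)%g \in G by move=> Gy k;
  rewrite groupM.
(* Both sides of an equivariance condition become one matrix, with [y] moved to the second
   transversal as y^-1. *)
have shift k l (a : 'I_k -> gT) (b : 'I_l -> gT) y :
    transversal_mx S (fun j => a j * y)%g b =
    transversal_mx S a (fun j => b j * y^-1)%g.
  by apply: eq_mxblock => j h /=; rewrite invMg invgK mulgA.
exists (i *m transversal_mx S t u), (transversal_mx S u t *m q);
  split=> [|y Gy|y Gy].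
- rewrite -mulmxA (mulmxA _ _ q) tuM transversal_mx1 ?mul1mx //.
  exact: coset_rep_uniq.
- rewrite mulmxA homi // -!mulmxA; congr (_ *m _).
  rewrite /= ind_u induced_transversal.
  by rewrite (transversal_mxM S u (meet_t _ _ (Gty y Gy))) !(shift _ _ _ u y)
    tuM.
- rewrite -mulmxA -homq // !mulmxA; congr (_ *m _).
  rewrite /= ind_u induced_transversal.
  by rewrite (transversal_mxM S t (meet_u _ _ (Guy y Gy))) !(shift _ _ _ t y)
    utM.
Qed.

End Candidates.

(** * Sums over cosets and their orbits *)

Lemma vertex_candidate_coset_decomposition (F : fieldType) (gT : finGroupType)
    (G Q : {group gT}) n (rG : mx_representation F G n) :
  vertex_candidate rG Q ->
  exists f : {set gT} -> 'M[F]_n,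
    \sum_(C in rcosets Q G) f C = 1%:M
    /\ forall C x, C \in rcosets Q G -> x \in G ->
         f (C :* x)%g = rG x^-1%g *m f C *m rG x.
Proof.
case=> sQG [m [S [_ /retract_of_summand[i [q [iq homi homq]]]]]].
pose t := @coset_rep _ Q G.
pose P (k : 'I_#|G : Q|%g) : 'M[F]_(\sum_(l < #|G : Q|%g) m) :=
  \mxdiag_l ((l == k)%:R%:M : 'M[F]_m).
have sumP : \sum_k P k = 1%:M.
  rewrite -mxdiag_sum -(mxdiagZ (p_ := fun=> m)); apply: eq_mxdiag => l.
  rewrite (bigD1 l) //= eqxx big1 ?addr0 // => k.
  by rewrite eq_sym => /negPf->; rewrite raddf0.
(* Here Q t_k x = Q t_l, so [x] carries the block of t_k to that of t_l. *)
have PJ k l x : (t k * x * (t l)^-1)%g \in Q ->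
    P k *m induced_mx G S x = induced_mx G S x *m P l.
  move=> Qkl; rewrite /P mul_mxdiag_mxblock mul_mxblock_mxdiag.
  apply: eq_mxblock => a b /=; rewrite mul_scalar_mx mul_mx_scalar.
  have [->|ne_ak] := eqVneq a k; have [->|ne_bl] := eqVneq b l;
    rewrite ?scale0r //.
    rewrite scale1r; case: ifP => // Qkb; case/eqP: ne_bl.
    apply: coset_rep_uniq; rewrite -groupV in Qkb.
    by have := groupM Qkb Qkl; rewrite invMg invgK mulgA mulgKV.
  rewrite scale1r; case: ifP => // Qal; case/eqP: ne_ak.
  apply: coset_rep_uniq; rewrite -groupV in Qkl.
  by have := groupM Qal Qkl; rewrite !invMg invgK !mulgA mulgKV mulgK.
(* At most one term: for a coset, the compression to M of the projection onto its block. *)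
pose f (C : {set gT}) := \sum_(k | enum_val k == C) i *m P k *m q.
have fE k : f (enum_val k) = i *m P k *m q.
  by apply: big_pred1 => l /=; rewrite (inj_eq enum_val_inj).
exists f; split=> [|C x].
  rewrite -iq -[i in RHS]mulmx1 -sumP mulmx_sumr mulmx_suml.
  by rewrite big_enum_val; apply: eq_bigr => k _; rewrite fE.
move=> QC Gx; have CE : C = enum_val (enum_rank_in QC C) by rewrite
  enum_rankK_in.
rewrite CE; set k := enum_rank_in QC C.
have [l Qkl] := coset_rep_ex k Gx.
have -> : (enum_val k :* x)%g = enum_val l.
  have repK a : (Q :* t a)%g = enum_val a.
    have /rcosetsP[y _ Ea] := enum_valP a.
    by rewrite /t /coset_rep Ea rcoset_repr.
  by rewrite -!repK -rcosetM; apply/rcoset_eqP; rewrite mem_rcoset.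
rewrite !fE !mulmxA homi ?groupV // -!mulmxA -homq // (mulmxA (P k)).
rewrite (PJ k l x Qkl) -!mulmxA; congr (_ *m _).
rewrite [RHS](mulmxA (induced_repr G S _) (induced_repr G S _)).
by rewrite -repr_mxM ?groupV // mulVg repr_mx1 mul1mx.
Qed.

(** The e^j with j < p represent the cosets of H in E, and H contains the stabilizer of C in E. So
    the E-orbit of C is the disjoint union of the translates of its H-orbit by the e^j. *)
Lemma sum_rcoset_orbit (gT : finGroupType) (V : nmodType) (E H : {group gT})
    (e : gT) (p : nat) (C : {set gT}) (f : {set gT} -> V) :
  H \subset E -> e \in E ->
  (forall x, x \in E -> (C :* x)%g = C -> x \in H) ->
  (forall x, x \in E -> exists j : 'I_p, (x * e ^- j)%g \in H
     /\ forall j' : 'I_p, (x * e ^- j')%g \in H -> j' = j) ->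
  \sum_(D in orbit 'Rs%act E C) f D =
    \sum_(j < p) \sum_(D in orbit 'Rs%act H C) f (D :* e ^+ j)%g.
Proof.
move=> sHE Ee stabC uniqE; set T := orbit _ H C.
have uniqT D : D \in orbit 'Rs%act E C -> exists j : 'I_p,
    (fun i : 'I_p => (D :* e ^- i)%g \in T) =1 pred1 j.
  case/orbitP=> x Ex <-; rewrite /= rcosetE; have [j [Hj uniqj]] := uniqE x Ex.
  exists j => i /=; apply/orbitP/eqP=> [[h Hh] | ->]; last first.
    exists (x * e ^- j)%g => //. by rewrite /= rcosetE rcosetM.
  rewrite /= rcosetE => Ei; apply: uniqj;
    rewrite -[(x * _)%g](mulgKV h) groupM //.
  have Eh := subsetP sHE h Hh.
  apply: stabC; first by rewrite !groupM ?groupV ?groupX.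
  by rewrite !rcosetM -Ei -rcosetM mulgV rcoset1.
(* Insert a sum over the unique admissible j, exchange the sums, then translate by e^j. *)
rewrite (eq_bigr (fun D => \sum_(j < p | (D :* e ^- j)%g \in T) f D));
  last first.
  by move=> D /uniqT[j Ej]; rewrite (big_pred1 j).
rewrite (exchange_big_dep predT) //=; apply: eq_bigr => j _.
have inj_e : injective (fun D : {set gT} => (D :* e ^+ j)%g).
  by move=> D D'; rewrite -!rcosetE; apply: (act_inj 'Rs%act).
rewrite (reindex_inj inj_e) /=; apply: eq_bigl => D.
rewrite -rcosetM mulgV rcoset1 andb_idl // => /orbitP[h Hh <-] /=.
rewrite !rcosetE -rcosetM -rcosetE; apply: (mem_orbit 'Rs%act).
by rewrite groupM ?groupX // (subsetP sHE).
Qed.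

(** * Base hyperplanes and maximal subgroups of E *)

Section Hyperplanes.

Variables (F : fieldType) (gT : finGroupType) (E : {group gT}) (p r : nat).
Variables (g : 'I_r -> gT).
Hypotheses (charFp : p \in [pchar F]) (abelE : (p.-abelem E)%g).
Hypothesis (genE : <<[set g i | i : 'I_r]>>%g = E :> {set gT}).

(** The equation with coefficients nu_i cuts out a hyperplane over the prime field; since nu_k = 1,
    it has the basis e_i - nu_i e_k for i != k. *)
Lemma proper_base_unionI (k : 'I_r) (nu : 'I_r -> nat) (alpha : 'rV[F]_r) :
  (nu k)%:R = 1 :> F -> \sum_i alpha 0 i * (nu i)%:R = 0 ->
  proper_base_union alpha.
Proof.
move=> nuk sum0; have p_gt0 := prime_gt0 (pcharf_prime charFp).
(* [lift k] runs over the indices other than [k]; -nu_i is written nu_i (p - 1) because the entries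
   must be images of naturals. *)
pose B : 'M[F]_(r.-1, r) := \matrix_i (delta_mx 0 (lift k i)
   + (nu (lift k i) * p.-1)%:R *: delta_mx 0 k).
have BE i j : B i j = ((lift k i == j) + (nu (lift k i) * p.-1) * (k == j))%:R.
  by rewrite !mxE eqxx /= natrD [in RHS]natrM ![j == _]eq_sym.
have predp : p.-1%:R = -1 :> F.
  by apply/eqP; rewrite -addr_eq0 natr1 prednK // (pcharf0 charFp).
have freeB : row_free B.
  (* Deleting column [k] of [B] leaves the identity. *)
  apply/row_freeP; exists (\matrix_(i, j) (i == lift k j)%:R).
  apply/matrixP=> i j; rewrite !mxE (bigD1 (lift k j)) //= big1 => [|l ne_l].
    rewrite BE !mxE eqxx mulr1 addr0 (inj_eq lift_inj).
    by rewrite (negPf (neq_lift k j)) muln0 addn0.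
  by rewrite !mxE (negPf ne_l) mulr0.
exists <<B>>%MS; split.
- exists r.-1, B; split=> //; first by apply/eqmx_sym/genmxE.
  by move=> i j; eexists; apply: BE.
- rewrite ltmxE submx1 /= sub1mx /row_full genmxE neq_ltn.
  by rewrite (leq_ltn_trans (rank_leq_row B)) // ltn_predL (leq_ltn_trans _
    (ltn_ord k)).
rewrite genmxE; apply/submxP; exists (\row_i alpha 0 (lift k i)).
apply/rowP=> j; rewrite mxE; case: (unliftP k j) => [j' -> | ->].
  have kj' : (k == lift k j') = false by apply: negPf; apply: neq_lift.
  rewrite (bigD1 j') //= big1 => [|l ne_l]; rewrite BE mxE kj' muln0 addn0.
    by rewrite eqxx mulr1 addr0.
  by rewrite (inj_eq lift_inj) (negPf ne_l) mulr0.
move: sum0; rewrite (bigD1_ord k) //= nuk mulr1 => /eqP.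
rewrite addr_eq0 -sumrN => /eqP ->; apply: eq_bigr => i _.
by rewrite BE mxE eqxx eq_sym (negPf (neq_lift _ _)) muln1 natrM predp mulrN1
  mulrN.
Qed.

(** Take a maximal subgroup H of E above K. Some generator g_k lies outside H, so E is the direct
    product of H and <g_k>, and nu_i is the exponent of g_k in g_i. If the sum vanished, alpha would
    lie on a base hyperplane. *)
Lemma maximal_direction (K : {group gT}) (alpha : 'rV[F]_r) :
  K \proper E -> ~ proper_base_union alpha ->
  exists (H : {group gT}) (k : 'I_r) (nu : 'I_r -> nat),
    [/\ K \subset H, H \subset E,
        forall x, x \in E -> exists j : 'I_p, (x * g k ^- j)%g \in H
          /\ forall j' : 'I_p, (x * g k ^- j')%g \in H -> j' = j,
        forall i, (g i * g k ^- nu i)%g \in H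
      & \sum_i alpha 0 i * (nu i)%:R != 0].
Proof.
move=> /andP[sKE nsEK] alphaN; have p_pr := pcharf_prime charFp.
have Eg i : g i \in E by rewrite -genE mem_gen // imset_f.
have /(abelemP p_pr)[abE expE] := abelE.
have [EK | [H maxH sKH]] := maximal_exists sKE;
  first by rewrite EK subxx in nsEK.
have sHE : H \subset E by case/maxgroupp/andP: maxH.
have [k Hk] : exists k, g k \notin H.
  apply/existsP; rewrite -negb_forall; apply: contraTN (maxgroupp maxH).
  move/forallP=> Hg; rewrite properE negb_and negbK sHE /= -genE gen_subG.
  by apply/subsetP=> _ /imsetP[i _ ->].
have gkp : (g k ^+ p = 1)%g by apply: expE.
have ok : #[g k]%g = p.
  by apply: nt_prime_order => //; apply: contraNneq Hk => ->.
have tiH : (<[g k]> :&: H = 1)%g.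
  by apply: prime_TIg; rewrite ?cycle_subG // -orderE ok.
have HgE : (H * <[g k]> = E)%g.
  apply: mulg_normal_maximal; rewrite ?cycle_subG //.
  by rewrite -sub_abelian_normal.
have uniqE x : x \in E -> exists j : 'I_p, (x * g k ^- j)%g \in H
     /\ forall j' : 'I_p, (x * g k ^- j')%g \in H -> j' = j.
  rewrite -HgE => /mulsgP[h _ Hh /cycleP[j ->] ->].
  exists (Ordinal (ltn_pmod j (prime_gt0 p_pr))) => /=.
  rewrite (expg_mod _ gkp) mulgK; split=> // j';
    rewrite -mulgA groupMl // => Hjj'.
  apply/val_inj; rewrite /= -(modn_small (ltn_ord j')); apply/eqP.
  have : (g k ^+ j * g k ^- j')%g \in (<[g k]> :&: H)%g.
    by rewrite inE Hjj' groupM ?groupV ?mem_cycle.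
  by rewrite tiH inE -eq_mulgV1 eq_expg_mod_order ok eq_sym.
have [nu Hnu] := fin_all_exists (fun i => uniqE (g i) (Eg i)).
exists H, k, (fun i => nat_of_ord (nu i)); split=> // [i|];
  first by case: (Hnu i).
apply/eqP=> c0; apply: alphaN; apply: (proper_base_unionI (k := k)) c0.
(* The exponent of g_k itself is 1, which is below p. *)
have [_ uniqk] := Hnu k; rewrite /= -(uniqk (Ordinal (prime_gt1 p_pr))) //=.
by rewrite expg1 mulgV group1.
Qed.

End Hyperplanes.

(** * Frobenius identities for polynomials and matrices *)

Section FrobeniusPowers.

Variables (F : fieldType) (p : nat).
Hypothesis charFp : p \in [pchar F].

(** Proved in F[X], where X - 1 cancels from X^p - 1 = (X - 1)^p; for a matrix A, A - 1 may be
    singular. *)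
Lemma sum_expX_pchar : \sum_(j < p) 'X^j = ('X - 1) ^+ p.-1 :> {poly F}.
Proof.
have charP : p \in [pchar {poly F}] by rewrite pchar_lalg.
have nzX : 'X - 1 != 0 :> {poly F} by rewrite -polyC1 polyXsubC_eq0.
apply: (mulfI nzX); rewrite -subrX1 -exprS prednK ?prime_gt0 ?(pcharf_prime
  charFp) //.
rewrite -!(pFrobenius_autE charP) pFrobenius_autB_comm ?pFrobenius_aut1 //.
exact: commr1.
Qed.

Lemma sum_expmx_pchar N (A : 'M[F]_N) : \sum_(j < p) A ^+ j = (A - 1) ^+ p.-1.
Proof.
case: N A => [|N] A; first exact: etrans (flatmx0 _) (esym (flatmx0 _)).
have := congr1 (horner_mx A) sum_expX_pchar.
rewrite rmorph_sum rmorphXn rmorphB rmorph1 /= horner_mx_X => <-.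
by apply: eq_bigr => j _; rewrite rmorphXn /= horner_mx_X.
Qed.

Lemma expmx_sum_pchar N (I : finType) (P : pred I) (A : I -> 'M[F]_N) :
  (forall i j, GRing.comm (A i) (A j)) ->
  (\sum_(i | P i) A i) ^+ p = \sum_(i | P i) A i ^+ p.
Proof.
move=> cA; rewrite -big_filter -[RHS]big_filter;
  elim: (filter _ _) => [|i s IHs].
  by rewrite !big_nil expr0n gtn_eqF ?prime_gt0 ?(pcharf_prime charFp).
rewrite !big_cons -IHs; apply: mx_expDp => //.
by apply: commr_sum.
Qed.

Lemma exprZmx N (a : F) (A : 'M[F]_N) k : (a *: A) ^+ k = a ^+ k *: A ^+ k.
Proof.
elim: k => [|k IHk]; first by rewrite !expr0 scale1r.
by rewrite !exprS IHk -[LHS]scalemxAl -scalemxAr scalerA.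
Qed.

End FrobeniusPowers.

(** * Traces and shifted units for two commuting actions *)

Section ShiftedTrace.

Variables (F : fieldType) (gT : finGroupType) (E H : {group gT}) (p r N : nat).
(** [L] and [R] will be left and right multiplication on endomorphisms of M, and [v] an endomorphism
    commuting with H; [D] and [Y] are then the commutators with e and with u_alpha. *)
Variables (L R : mx_representation F E N) (v : 'rV[F]_N).
Variables (e : gT) (g : 'I_r -> gT) (nu : 'I_r -> nat) (alpha : 'rV[F]_r).
Hypotheses (charFp : p \in [pchar F]) (abelE : (p.-abelem E)%g).
Hypothesis cLR : forall x y, x \in E -> y \in E -> L x *m R y = R y *m L x.
Hypothesis vH : forall h, h \in H -> v *m L h = v *m R h.
Hypotheses (Ee : e \in E) (Eg : forall i, g i \in E).
Hypothesis Hg : forall i, (g i * e ^- nu i)%g \in H.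
Hypothesis c_neq0 : \sum_i alpha 0 i * (nu i)%:R != 0.

(* On vectors v fixed by H as in [vH], Y acts as kappa * D, and kappa is
   invertible because kappa ^+ p is the scalar (\sum_i alpha_i nu_i) ^+ p. *)
Let h i := (g i * e ^- nu i)%g.
Let S i := \sum_(a < nu i) R e ^+ ((nu i).-1 - a) * L e ^+ a.
Let kappa := \sum_i alpha 0 i *: (L (h i) * S i).
Let D := R e - L e.
Let Y := \sum_i alpha 0 i *: (R (g i) - L (g i)).
(** All operators here lie in the commutative algebra generated by the [L x] and [R x]; commutation
    is checked on these generators. *)
Let central (A : 'M[F]_N) :=
  forall x, x \in E -> GRing.comm A (L x) /\ GRing.comm A (R x).

Let Eh i : h i \in E.
Proof. by rewrite groupM ?groupV ?groupX. Qed.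

Let abE x y : x \in E -> y \in E -> (x * y = y * x)%g.
Proof. by move=> Ex Ey; apply: (centsP (abelem_abelian abelE)). Qed.

Let centralL x : x \in E -> central (L x).
Proof.
move=> Ex y Ey; split; last exact: cLR.
by rewrite /GRing.comm -![_ * _]repr_mxM // abE.
Qed.

Let centralR x : x \in E -> central (R x).
Proof.
move=> Ex y Ey; split; first by apply/esym/cLR.
by rewrite /GRing.comm -![_ * _]repr_mxM // abE.
Qed.

Let commZ (a : F) (A B : 'M[F]_N) : GRing.comm A B -> GRing.comm A (a *: B).
Proof.
by move=> cAB; rewrite /GRing.comm -[LHS]scalemxAr -[RHS]scalemxAl;
  congr (_ *: _).
Qed.

Let commS A i : central A -> GRing.comm A (S i).
Proof.
move=> cA; have [cL cR] := cA e Ee; apply: commr_sum => a _.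
by apply: commrM; apply: commrX.
Qed.

Let commk A : central A -> GRing.comm A kappa.
Proof.
move=> cA; apply: commr_sum => i _; apply/commZ/commrM; last exact: commS.
by have [] := cA _ (Eh i).
Qed.

Let commD A : central A -> GRing.comm A D.
Proof. by move=> cA; have [cL cR] := cA e Ee; apply: commrB. Qed.

Let commY A : central A -> GRing.comm A Y.
Proof.
move=> cA; apply: commr_sum => i _; apply/commZ.
by have [cL cR] := cA _ (Eg i); apply: commrB.
Qed.

Let centralk : central kappa.
Proof. by move=> x Ex; split; apply/commr_sym/commk;
  [apply: centralL | apply: centralR]. Qed.

Let centralD : central D.
Proof. by move=> x Ex; split; apply/commr_sym/commD;
  [apply: centralL | apply: centralR]. Qed.

Let centralS i : central (S i).
Proof. by move=> x Ex; split; apply/commr_sym/commS;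
  [apply: centralL | apply: centralR]. Qed.

Let expL k x : x \in E -> L (x ^+ k)%g = L x ^+ k.
Proof.
move=> Ex; elim: k => [|k IHk]; first by rewrite repr_mx1.
by rewrite expgS exprS repr_mxM ?groupX // IHk.
Qed.

Let expR k x : x \in E -> R (x ^+ k)%g = R x ^+ k.
Proof.
move=> Ex; elim: k => [|k IHk]; first by rewrite repr_mx1.
by rewrite expgS exprS repr_mxM ?groupX // IHk.
Qed.

Let p_pr : prime p := pcharf_prime charFp.

Let expEp x : x \in E -> (x ^+ p = 1)%g.
Proof. by have /(abelemP p_pr)[_ expE] := abelE; apply: expE. Qed.

Let Lp x : x \in E -> L x ^+ p = 1.
Proof. by move=> Ex; rewrite -expL // expEp // repr_mx1. Qed.

Let Rp x : x \in E -> R x ^+ p = 1.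
Proof. by move=> Ex; rewrite -expR // expEp // repr_mx1. Qed.

(** E has exponent p, so each of the nu_i commuting terms of [S i] has p-th power 1 and [S i ^+ p]
    is nu_i, which Frobenius fixes. *)
Lemma kappa_expp : kappa ^+ p = (\sum_i alpha 0 i * (nu i)%:R) ^+ p *: 1%:M.
Proof.
have Sp i : S i ^+ p = (nu i)%:R *: 1%:M.
  rewrite /S (expmx_sum_pchar charFp) => [|a b].
    rewrite (eq_bigr (fun=> 1%:M)) ?sumr_const ?card_ord ?scaler_nat // => a _.
    rewrite exprMn_comm; last by apply/commrX/commr_sym/commrX;
      case: (centralL Ee Ee).
    by rewrite -!exprM ![(_ * p)%N]mulnC !exprM Rp ?Lp // !expr1n mulr1.
  have [cLL cLR'] := centralL Ee Ee; have [cRL cRR] := centralR Ee Ee.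
  by apply: commrM; apply: commrX; apply/commr_sym; apply: commrM;
    apply: commrX.
rewrite /kappa (expmx_sum_pchar charFp) => [|i j]; last first.
  apply/commZ/commr_sym/commZ.
  have cLS k l : GRing.comm (L (h k)) (S l) by apply/commS/centralL.
  have cLL k l : GRing.comm (L (h k)) (L (h l)) by case: (centralL (Eh k) (Eh
    l)).
  by apply: commrM; apply/commr_sym; apply: commrM => //;
    [apply/commr_sym | apply/commS/centralS].
rewrite -(pFrobenius_autE charFp) rmorph_sum scaler_suml /=;
  apply: eq_bigr => i _.
rewrite exprZmx exprMn_comm; last by apply/commS/centralL.
by rewrite Sp Lp // mul1r scalerA pFrobenius_autE exprMn -!(pFrobenius_autE
  charFp) pFrobenius_aut_nat.
Qed.

(** Write g_i = h_i e^nu_i. On [v] the two actions of h_i agree, leaving R(e)^nu_i - L(e)^nu_i,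
    which is [D] times the geometric sum [S i]. *)
Lemma mul_shifted_sub : v *m Y = v *m (kappa * D).
Proof.
rewrite /Y /kappa [_ * D]mulmx_suml !mulmx_sumr; apply: eq_bigr => i _.
rewrite -scalemxAl -!scalemxAr; congr (_ *: _).
have gE : (g i = h i * e ^+ nu i)%g by rewrite mulgKV.
have Een : (e ^+ nu i)%g \in E by rewrite groupX.
rewrite gE (repr_mxM R (Eh i) Een) (repr_mxM L (Eh i) Een) expL // expR //.
rewrite mulmxBr 2!mulmxA -(vH (Hg i)) -!mulmxA -mulmxBr -mulmxBr.
congr (_ *m (_ *m _)); rewrite subrXX_comm; last by case: (centralR Ee Ee).
exact: (@commS D i centralD).
Qed.

(** The trace operator is (L(e^-1) R(e) - 1)^(p-1) = (L(e^-1) D)^(p-1). On [v], [D] may be replaced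
    by kappa^-1 Y, and the powers of [Y] commute to the right. *)
Lemma trace_shifted_image :
  exists w : 'rV[F]_N,
    v *m \sum_(j < p) (L e^-1%g *m R e) ^+ j = w *m Y ^+ p.-1.
Proof.
pose c := \sum_i alpha 0 i * (nu i)%:R.
(* The inverse of [kappa], read off from kappa^p = c^p. *)
pose iota : 'M[F]_N := (c ^- p) *: kappa ^+ p.-1.
have cki : GRing.comm kappa iota by apply/commZ/commrX.
have ki1 : kappa * iota = 1.
  rewrite -[LHS]scalemxAr -[_ *m _]exprS prednK ?prime_gt0 //.
  by rewrite kappa_expp scalerA mulVf ?scale1r // expf_neq0.
(* The relation v Y = v kappa D is known for [v] only, so kappa D is commuted past Y^k before the
   induction hypothesis is applied. *)
have vYk k : v *m Y ^+ k = v *m (kappa * D) ^+ k.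
  elim: k => [|k IHk]; first by [].
  have cYkD : GRing.comm (kappa * D) (Y ^+ k).
    by apply/commrX/commr_sym/commrM; apply/commr_sym/commY.
  rewrite exprS exprSr [LHS]mulmxA mul_shifted_sub -mulmxA [_ *m Y ^+ k]cYkD.
  by rewrite [LHS]mulmxA IHk -mulmxA.
have Ee' : e^-1%g \in E by rewrite groupV.
have T1 : L e^-1%g *m R e - 1 = L e^-1%g * D.
  by rewrite mulrBr -[L _ * L _](repr_mxM L Ee' Ee) mulVg repr_mx1.
rewrite (sum_expmx_pchar charFp) T1.
exists (v *m (iota ^+ p.-1 * L e^-1%g ^+ p.-1)).
have comm_ZY : GRing.comm (iota ^+ p.-1 * L e^-1%g ^+ p.-1) (Y ^+ p.-1).
  apply/commrX/commr_sym/commrM; apply/commrX/commr_sym;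
    last exact: commY (centralL Ee').
  by apply/commr_sym/commZ/commrX/commr_sym; apply: commY centralk.
have comm_Di : GRing.comm (D ^+ p.-1) (iota ^+ p.-1).
  by apply/commrX/commr_sym/commrX/commr_sym/commZ/commrX;
    apply: commk centralD.
rewrite -[RHS]mulmxA [_ *m Y ^+ _]comm_ZY [RHS]mulmxA vYk -mulmxA;
  congr (_ *m _).
change ((L e^-1%g * D) ^+ p.-1 =
  (kappa * D) ^+ p.-1 * (iota ^+ p.-1 * L e^-1%g ^+ p.-1)).
rewrite (exprMn_comm _ (commD (centralL Ee'))).
rewrite (exprMn_comm _ (commD centralk)) [RHS]mulrA -(mulrA (kappa ^+ _)).
rewrite comm_Di !mulrA -(exprMn_comm _ cki) ki1 expr1n mul1r.
by apply/commrX/commr_sym/commrX/commr_sym; apply: commD (centralL Ee').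
Qed.

End ShiftedTrace.

(** * Left and right multiplication on endomorphisms *)

Section MultiplicationOperators.

Variables (F : fieldType) (gT : finGroupType) (E : {group gT}) (n : nat).
Variable (rE : mx_representation F E n).
Hypothesis abE : abelian E.

(** Left multiplication reverses products, whence the hypothesis that E is abelian. *)
Lemma lin_mulmx_repr : mx_repr E (fun x => lin_mulmx (rE x) : 'M_(n * n)).
Proof.
split=> [|x y Ex Ey]; apply/row_matrixP=> i; rewrite !rowE.
  by rewrite repr_mx1 mul_rV_lin /= mul1mx vec_mxK mulmx1.
rewrite [RHS]mulmxA !mul_rV_lin /= mxvecK mulmxA -repr_mxM //.
by rewrite (centsP abE y Ey x Ex).
Qed.

Lemma lin_mulmxr_repr : mx_repr E (fun x => lin_mulmxr (rE x) : 'M_(n * n)).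
Proof.
split=> [|x y Ex Ey]; apply/row_matrixP=> i; rewrite !rowE.
  by rewrite repr_mx1 mul_rV_lin /= mulmx1 vec_mxK mulmx1.
by rewrite [RHS]mulmxA !mul_rV_lin mxvecK /= -mulmxA -repr_mxM.
Qed.

Definition left_mul_repr := MxRepresentation lin_mulmx_repr.
Definition right_mul_repr := MxRepresentation lin_mulmxr_repr.

Lemma left_right_mulC x y :
  left_mul_repr x *m right_mul_repr y = right_mul_repr y *m left_mul_repr x.
Proof.
apply/row_matrixP=> i; rewrite !rowE !mulmxA /= !mul_rV_lin !mxvecK /=.
by rewrite mulmxA.
Qed.

Lemma conj_trace_mxvec (A : 'M[F]_n) e k : e \in E ->
  mxvec A *m \sum_(j < k) (left_mul_repr e^-1%g *m right_mul_repr e) ^+ j =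
  mxvec (\sum_(j < k) rE (e ^- j)%g *m A *m rE (e ^+ j)%g).
Proof.
move=> Ee; rewrite mulmx_sumr linear_sum; apply: eq_bigr => j _ /=.
elim: {j}(j : nat) => [|j IHj].
  by rewrite invg1 repr_mx1 mul1mx !mulmx1.
rewrite exprSr mulmxA IHj mulmxA mul_vec_lin mul_vec_lin /=; congr mxvec.
rewrite !mulmxA -repr_mxM ?groupV ?groupX // -[LHS]mulmxA -repr_mxM ?groupX //.
by rewrite -invMg -!expgSr.
Qed.

Variables (r : nat) (g : 'I_r -> gT) (alpha : 'rV[F]_r).
Let Y := \sum_i alpha 0 i *: (rE (g i) - 1%:M).
Let adY := \sum_i alpha 0 i *: (right_mul_repr (g i) - left_mul_repr (g i)).

(** Each application of [adY] sends w to w Y - Y w, and u kills the second term. *)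
Lemma adjoint_kernel (u : 'rV[F]_n) (w : 'rV[F]_(n * n)) k :
  u *m Y = 0 -> u *m vec_mx (w *m adY ^+ k) = u *m vec_mx w *m Y ^+ k.
Proof.
move=> uY; elim: k w => [|k IHk] w; first by rewrite !mulmx1.
rewrite exprS mulmxA IHk [in RHS]exprS [RHS]mulmxA; congr (_ *m _).
have -> : vec_mx (w *m adY) = vec_mx w *m Y - Y *m vec_mx w.
  rewrite /adY /Y !mulmx_sumr mulmx_suml linear_sum -sumrB /=.
  apply: eq_bigr => i _; rewrite -!scalemxAr -scalemxAl linearZ -scalerBr /=.
  congr (_ *: _); rewrite mulmxBr linearB /= !mx_rV_lin /=.
  by rewrite mulmxBr mulmxBl mulmx1 mul1mx opprB addrA subrK.
by rewrite mulmxBr !mulmxA uY mul0mx subr0.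
Qed.

End MultiplicationOperators.

(** * From a decomposition of the identity to the kernel of Y *)

Lemma kernel_sub_image (F : fieldType) (gT : finGroupType) (E : {group gT})
    (p r n : nat) (rE : mx_representation F E n) (g : 'I_r -> gT)
    (alpha : 'rV[F]_r) (Omega : {set {set gT}}) (f : {set gT} -> 'M[F]_n)
    (Y := \sum_i alpha 0 i *: (rE (g i) - 1%:M)) :
  p \in [pchar F] -> (p.-abelem E)%g ->
  <<[set g i | i : 'I_r]>>%g = E :> {set gT} ->
  ~ proper_base_union alpha ->
  [acts E, on Omega | 'Rs%act] ->
  (forall C, C \in Omega -> ~~ (E \subset 'C[C | 'Rs%act]%g)) ->
  \sum_(C in Omega) f C = 1%:M ->
  (forall C x, C \in Omega -> x \in E ->
     f (C :* x)%g = rE x^-1%g *m f C *m rE x) ->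
  (kermx Y <= Y ^+ p.-1)%MS.
Proof.
move=> charFp abelE genE alphaN actE nfix sumf fJ.
have abE := abelem_abelian abelE.
have Eg i : g i \in E by rewrite -genE mem_gen // imset_f.
pose L := left_mul_repr rE abE; pose R := right_mul_repr rE.
pose adY := \sum_i alpha 0 i *: (R (g i) - L (g i)).
(* If 1 = (ad Y)^(p-1) w, then [adjoint_kernel] gives u = u w Y^(p-1) for u in the kernel. *)
suffices [w w1] : exists w, mxvec 1%:M = w *m adY ^+ p.-1.
  apply/rV_subP=> u /sub_kermxP uY; apply/submxP; exists (u *m vec_mx w).
  rewrite -(adjoint_kernel abE _ _ uY) -[X in X = _]mulmx1.
  by rewrite -[1%:M](mxvecK) w1.
(* A row space is closed under sums, so each E-orbit can be treated separately, with its own H and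
   e. *)
apply/submxP; rewrite -sumf linear_sum (set_partition_big _ (orbit_partition
  actE)) /=.
apply: summx_sub => _ /imsetP[C OC ->]; rewrite -linear_sum /=.
have OCE D : D \in orbit 'Rs%act E C -> D \in Omega.
  by case/orbitP=> x Ex <-; rewrite (acts_act actE).
pose K := 'C_E[C | 'Rs]%G.
have prK : K \proper E.
  by rewrite properE subsetIl /= subsetI subxx /= nfix.
have [H [k [nu [sKH sHE uniqE Hg c_neq0]]]] :=
  maximal_direction charFp abelE genE prK alphaN.
have stabC x : x \in E -> (C :* x)%g = C -> x \in H.
  move=> Ex Cx; apply: (subsetP sKH); rewrite !inE Ex sub1set inE /=.
  by rewrite rcosetE Cx.
rewrite (sum_rcoset_orbit f sHE (Eg k) stabC uniqE).
pose T := orbit 'Rs%act H C; pose theta := \sum_(D in T) f D.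
have OT D : D \in T -> D \in Omega.
  case/orbitP=> x Hx <-; apply: OCE; apply: mem_orbit.
  by rewrite (subsetP sHE).
have thetaE j : \sum_(D in T) f (D :* g k ^+ j)%g
    = rE (g k ^- j)%g *m theta *m rE (g k ^+ j)%g.
  rewrite /theta mulmx_sumr mulmx_suml; apply: eq_bigr => D TD.
  by rewrite fJ ?groupX // OT.
rewrite (eq_bigr _ (fun (j : 'I_p) _ => thetaE j)) -(conj_trace_mxvec rE abE)
  //.
(* H permutes the H-orbit [T], so conjugation by H fixes [theta]. *)
have vH h : h \in H -> mxvec theta *m L h = mxvec theta *m R h.
  move=> Hh; have Eh := subsetP sHE h Hh; rewrite !mul_vec_lin /=; congr mxvec.
  have {1}-> : theta = rE h^-1%g *m theta *m rE h.
    rewrite {1}/theta (reindex_astabs 'Rs%act h) /=; last first.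
      by apply: (subsetP (acts_orbit 'Rs%act C (subsetT H))).
    rewrite /theta mulmx_sumr mulmx_suml; apply: eq_bigr => D TD.
    by rewrite rcosetE fJ ?OT.
  by rewrite !mulmxA -repr_mxM ?groupV // mulgV repr_mx1 mul1mx.
have [w ->] := trace_shifted_image charFp abelE
  (fun x y _ _ => left_right_mulC rE abE x y) vH (Eg k) Eg Hg c_neq0.
exact: submxMl.
Qed.

(** * Freeness from the kernel and image of a nilpotent operator *)

Section FreeCriterion.

Variables (F : fieldType) (n p : nat).

(** For k < p the image of Y^k contains ker Y = im Y^(p-1), so every step from Y^k to Y^(k+1) loses
    the same rank: all Jordan blocks have size p. *)
Lemma rank_exp_ker_image (Y : 'M[F]_n) :
  Y ^+ p = 0 -> (kermx Y <= Y ^+ p.-1)%MS -> (0 < p)%N ->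
  (p * \rank (Y ^+ p.-1) = n)%N.
Proof.
move=> Yp kerY p_gt0.
have kerE : (kermx Y :=: Y ^+ p.-1)%MS.
  apply/eqmxP; rewrite kerY; apply/sub_kermxP.
  by rewrite -[_ *m _]exprSr prednK.
have step k : (k < p)%N -> (\rank (Y ^+ k.+1) + \rank (Y ^+ p.-1) = \rank (Y ^+
  k))%N.
  move=> lt_kp; rewrite -(mxrank_mul_ker (Y ^+ k) Y) -[_ *m _]exprSr;
    congr (_ + _)%N.
  have <- : \rank (kermx Y) = \rank (Y ^+ p.-1) by rewrite kerE.
  apply/eqP; rewrite eqn_leq (mxrankS (capmxSr _ _)) andbT.
  rewrite mxrankS // sub_capmx submx_refl andbT.
  rewrite (submx_trans kerY) // -(subnK (_ : k <= p.-1)%N) ?exprD ?submxMl //.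
  by rewrite -ltnS prednK.
have rank_k k : (k <= p)%N -> (\rank (Y ^+ k) + k * \rank (Y ^+ p.-1) = n)%N.
  elim: k => [_|k IHk lt_kp]; first by rewrite mxrank1 mul0n addn0.
  by rewrite mulSn addnA step // IHk // ltnW.
by rewrite -[RHS](rank_k p) // Yp mxrank0.
Qed.

Variables (gT : finGroupType) (E : {group gT}) (rN : mx_representation F E n).
Variable u : 'M[F]_(gcard E).
Hypothesis Ru : (u \in group_ring F E)%MS.

Lemma gring_op_exp j : gring_op rN (u ^+ j) = gring_op rN u ^+ j.
Proof.
elim: j => [|j IHj]; first exact: gring_op1.
by rewrite [in LHS]exprSr gring_opM // IHj exprSr.
Qed.

Section PowerCombination.

Variables (d : nat) (b : 'M[F]_(d, n)) (U : 'M[F]_n).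

(** The double sum of [free_on_powers], ordered by powers and viewed as linear in [c]: unique
    solvability becomes full row and column rank of its matrix. *)
Definition power_comb (c : 'M[F]_(d, p)) : 'rV[F]_n :=
  \sum_(j < p) (col j c)^T *m b *m U ^+ j.

Fact power_comb_is_linear : linear power_comb.
Proof.
move=> a c c'; rewrite /power_comb scaler_sumr -big_split;
  apply: eq_bigr => j _ /=.
by rewrite !linearP /= !mulmxDl -!scalemxAl.
Qed.

HB.instance Definition _ :=
  GRing.isLinear.Build F 'M[F]_(d, p) 'rV[F]_n _ power_comb
    power_comb_is_linear.

Definition power_comb_mx : 'M[F]_(d * p, n) := lin1_mx (power_comb \o vec_mx).

Lemma power_combE c : power_comb c = mxvec c *m power_comb_mx.
Proof. by rewrite mul_rV_lin1 /= mxvecK. Qed.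

(** Induction on k shows that ker Y^k lies in the span. For w in ker Y^(k+1), w Y^k lies in ker Y,
    hence equals a b Y^(p-1) for some a, and w - a b Y^(p-1-k) lies in ker Y^k. *)
Lemma power_comb_full :
  (U - 1) ^+ p = 0 -> (kermx (U - 1) <= b *m (U - 1) ^+ p.-1)%MS -> (0 < p)%N ->
  row_full power_comb_mx.
Proof.
set Y := U - 1; move=> Yp kerY p_gt0.
(* Each factor Y = U - 1 is traded for powers of U; j + k < p keeps their exponents below p. *)
have im_YU j k : (j + k < p)%N -> (b *m Y ^+ j *m U ^+ k <= power_comb_mx)%MS.
  elim: j k => [|j IHj] k lt_p.
    apply/rV_subP=> _ /submxP[a ->]; rewrite !mulmxA mulmx1.
    pose c : 'M[F]_(d, p) := \matrix_(l, i) (a 0 l *+ (i == k :> nat)).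
    have colc i : (col i c)^T = a *+ (i == k :> nat).
      by apply/rowP=> l; rewrite !mxE mulmxnE.
    have <- : power_comb c = a *m b *m U ^+ k.
      rewrite /power_comb (bigD1 (Ordinal lt_p)) //= big1 => [|i ne_ik].
        by rewrite addr0 colc eqxx.
      by rewrite colc (_ : (_ == _) = false) ?mul0mx //; apply: negPf.
    by rewrite power_combE submxMl.
  have -> : b *m Y ^+ j.+1 *m U ^+ k = b *m Y ^+ j *m U ^+ k.+1 - b *m Y ^+ j
    *m U ^+ k.
    rewrite exprSr mulmxA -!mulmxA -!mulmxBr; congr (_ *m (_ *m _)).
    by rewrite [_ *m U ^+ k]mulrBl mul1r exprS.
  by rewrite addmx_sub ?eqmx_opp ?IHj ?addnS // ltnW.
have im_ker k : (k <= p)%N -> (kermx (Y ^+ k) <= power_comb_mx)%MS.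
  elim: k => [_|k IHk lt_kp].
    have -> : kermx (Y ^+ 0) = 0 by apply/eqP;
      rewrite kermx_eq0 row_free_unit unitmx1.
    exact: sub0mx.
  apply/rV_subP=> w /sub_kermxP wY.
  have /submxP[a wE] : (w *m Y ^+ k <= b *m Y ^+ p.-1)%MS.
    apply: submx_trans kerY; apply/sub_kermxP.
    by rewrite -mulmxA -[_ *m Y]exprSr.
  have le_kp : (k <= p.-1)%N by rewrite -ltnS prednK.
  rewrite -[w](subrK (a *m (b *m Y ^+ (p.-1 - k)))) addmx_sub //.
    apply: submx_trans (IHk (ltnW lt_kp)); apply/sub_kermxP.
    rewrite mulmxBl wE -!mulmxA -[Y ^+ _ *m Y ^+ k]exprD subnK //.
    by rewrite subrr.
  apply: submx_trans (submxMl _ _) _.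
  have := im_YU (p.-1 - k)%N 0%N; rewrite mulmx1 addn0; apply.
  by rewrite -[X in (_ < X)%N](prednK p_gt0) ltnS leq_subr.
by rewrite -sub1mx; have := im_ker p (leqnn p); rewrite Yp;
  apply: submx_trans; rewrite kermx0.
Qed.

End PowerCombination.

(** Lift a basis of the image of Y^(p-1) to [b]. The resulting vectors span, and their number p *
    rank(Y^(p-1)) is n, so they form a basis. *)
Lemma free_of_ker_image (Y := gring_op rN u - 1) :
  (0 < p)%N -> Y ^+ p = 0 -> (kermx Y <= Y ^+ p.-1)%MS ->
  free_on_powers p rN u.
Proof.
move=> p_gt0 Yp kerY; set U := gring_op rN u in Y Yp kerY.
pose Z := Y ^+ p.-1.
pose b : 'M_(\rank Z, n) := row_base Z *m pinvmx Z.
have bZ : b *m Z = row_base Z by rewrite mulmxKpV // eq_row_base.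
have full : row_full (power_comb_mx b U).
  by apply: power_comb_full => //; rewrite bZ eq_row_base.
have free : row_free (power_comb_mx b U).
  by rewrite /row_free (eqP full) mulnC rank_exp_ker_image.
exists (\rank Z), b => w.
have combE (c : 'M[F]_(\rank Z, p)) :
    \sum_i row i b *m gring_op rN (\sum_(j < p) c i j *: u ^+ j)
    = mxvec c *m power_comb_mx b U.
  rewrite -power_combE; under eq_bigr => i _.
    rewrite linear_sum mulmx_sumr.
    under eq_bigr => j _ do rewrite linearZ /= gring_op_exp.
    over.
  rewrite exchange_big; apply: eq_bigr => j _ /=.
  rewrite [_^T *m b]mulmx_sum_row mulmx_suml; apply: eq_bigr => i _.
  by rewrite !mxE -scalemxAl -scalemxAr.
have /submxP[c wE] : (w <= power_comb_mx b U)%MS by apply: submx_full.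
exists (vec_mx c); split=> [|c']; first by rewrite combE vec_mxK.
by rewrite combE wE => /(row_free_inj free) ->; rewrite mxvecK.
Qed.

End FreeCriterion.

(** * The action of u_alpha on a module *)

Section ShiftedUnitAction.

Variables (F : fieldType) (gT : finGroupType) (E : {group gT}) (p r n : nat).
Variables (g : 'I_r -> gT) (alpha : 'rV[F]_r) (rE : mx_representation F E n).
Hypothesis Eg : forall i, g i \in E.

Lemma shifted_unit_ring : (shifted_unit E g alpha \in group_ring F E)%MS.
Proof.
have ring1 : (1%:M \in group_ring F E)%MS.
  by rewrite -(repr_mx1 (regular_repr F E)) envelop_mx_id.
rewrite /shifted_unit linearD addmx_sub // linear_sum summx_sub // => i _.
rewrite linearZ scalemx_sub // linearB addmx_sub ?eqmx_opp //.
by rewrite envelop_mx_id.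
Qed.

Lemma gring_op_shifted_unit :
  gring_op rE (shifted_unit E g alpha)
    = 1 + \sum_i alpha 0 i *: (rE (g i) - 1%:M).
Proof.
rewrite /shifted_unit linearD /= gring_op1 linear_sum; congr (_ + _).
by apply: eq_bigr => i _; rewrite linearZ linearB /= gring_opG // gring_op1.
Qed.

(** Frobenius on u = (u - 1) + 1 gives 1 = u^p = (u - 1)^p + 1. *)
Lemma gring_op_shifted_unit_nilpotent :
  p \in [pchar F] -> (p.-abelem E)%g ->
  (gring_op rE (shifted_unit E g alpha) - 1) ^+ p = 0.
Proof.
move=> charFp abelE; have p_pr := pcharf_prime charFp.
have := @mx_expDp _ _ charFp n (gring_op rE (shifted_unit E g alpha) - 1) 1.
rewrite subrK -gring_op_exp ?shifted_unit_ring // (shifted_unit_expp charFp) //.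
rewrite [gring_op rE 1]gring_op1 expr1n [_ *m 1]mulmx1 [1 *m _]mul1mx => /(_
  erefl)/esym/eqP.
by rewrite -subr_eq0 addrK => /eqP.
Qed.

End ShiftedUnitAction.

(** * Green vertices and the conclusion *)

Lemma green_vertexJ (F : fieldType) (gT : finGroupType) (G Q : {group gT})
    n (rG : mx_representation F G n) x :
  x \in G -> green_vertex rG Q -> green_vertex rG (Q :^ x)%G.
Proof.
move=> Gx [candQ minQ]; split=> [|R sRQx candR]; first exact: vertex_candidateJ.
have := minQ (R :^ x^-1)%G; rewrite /= sub_conjgV => /(_ sRQx) <-.
  by rewrite conjsgKV.
by apply: vertex_candidateJ; rewrite ?groupV.
Qed.

(** Descent on the order from G itself; whether a smaller candidate exists is decided
    classically. *)
Lemma green_vertex_exists (F : fieldType) (gT : finGroupType) (G : {group gT})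
    n (rG : mx_representation F G n) :
  indecomposable rG -> exists Q : {group gT}, green_vertex rG Q.
Proof.
move=> indG; have [Q candQ] : exists Q : {group gT}, vertex_candidate rG Q.
  by exists G; apply: vertex_candidate_self.
have [m] := ubnP #|Q|; elim: m Q candQ => // m IHm Q candQ;
  rewrite ltnS => le_Qm.
have [[R [prRQ candR]] | minQ] :=
    classic (exists R : {group gT}, R \proper Q /\ vertex_candidate rG R).
  by apply: (IHm R) => //; apply: leq_trans le_Qm; apply: proper_card.
exists Q; split=> // R sRQ candR; apply/eqP; rewrite eqEproper sRQ.
by apply/negP=> prRQ; apply: minQ; exists R.
Qed.

Theorem theorem3p3 (F : closedFieldType) (p : nat) (charFp : p \in [pchar F]%R)
    (gT : finGroupType) (G : {group gT})
    (n : nat) (rG : mx_representation F G n) (indM : indecomposable rG)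
    (E : {group gT}) (sEG : E \subset G) (abelE : (p.-abelem E)%g)
    (r : nat) (rankE : ('r(E))%g = r)
    (g : 'I_r -> gT) (genE : <<[set g i | i : 'I_r]>>%g = E :> {set gT})
    (not_contained :
       ~ (forall alpha : 'rV[F]_r,
            rank_variety g p (subg_repr rG sEG) alpha ->
            proper_base_union alpha)) :
  exists Q : {group gT}, green_vertex rG Q /\ E \subset Q.
Proof.
have [Q vertQ] := green_vertex_exists indM.
case: (boolP [exists x in G, E \subset (Q :^ x)%g]) => [/existsP[x /andP[Gx
  sEQx]] | nEQ].
  by exists (Q :^ x)%G; split=> //; apply: green_vertexJ.
case: not_contained => alpha valpha; apply: NNPP => alphaN.
(* Right multiplication by E fixes Q x exactly when E lies in Q^x. *)
have nfix C : C \in rcosets Q G -> ~~ (E \subset 'C[C | 'Rs%act]%g).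
  case/rcosetsP=> x Gx ->; apply: contra nEQ => fixC.
  apply/existsP; exists x; rewrite Gx /=.
  rewrite -sub_afixRs_norms; apply/afixP=> y Ey.
  by have /astab1P := subsetP fixC y Ey.
have [f [sumf fJ]] := vertex_candidate_coset_decomposition vertQ.1.
have Eg i : g i \in E by rewrite -genE mem_gen // imset_f.
case: valpha => [alpha0 | [_ []]].
  (* The zero vector escapes the union only when no proper base subspace exists. It is excluded by
     [maximal_direction], whose sum would be 0 here. *)
  have QQ : gval Q \in rcosets Q G by apply/rcosetsP; exists 1%g;
    rewrite ?mulg1.
  have prKE : 'C_E[gval Q | 'Rs%act]%G \proper E.
    by rewrite properE subsetIl /= subsetI subxx /= nfix.
  have [H [k [nu [_ _ _ _ ]]]] := maximal_direction charFp abelE genE prKE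
    alphaN.
  by rewrite big1 ?eqxx // => i _; rewrite alpha0 mxE mul0r.
apply: free_of_ker_image.
- exact: shifted_unit_ring.
- exact: prime_gt0 (pcharf_prime charFp).
- exact: gring_op_shifted_unit_nilpotent.
rewrite gring_op_shifted_unit // [1 + _]addrC addrK.
apply: (kernel_sub_image charFp abelE genE alphaN _ nfix sumf).
  by apply: subset_trans sEG _; apply: actsRs_rcosets.
by move=> C x QC Ex; rewrite fJ // (subsetP sEG).
Qed.
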